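(* Let $k$ and $n$ be positive integers. If $A\in\{0,1\}^{n\times n}$ has the $k$-consecutive ones property, then $|\det(A)|\leq (2k)^{n/2}$. Furthermore, for every $k$ such that a Hadamard matrix of order $k$ exists and every $n$ for which $n/k$ is an integer, there is a matrix $A\in\{0,1\}^{n\times n}$ with the $k$-consecutive ones property and $|\det(A)|=k^{(n-k)/2}$.
   Context: A $0/1$-matrix has the $k$-consecutive ones property if in every row the $1$-entries form at most $k$ blocks of consecutive entries, i.e. each row has the form $0\ldots0\,1\ldots1\,0\ldots0\,1\ldots1\,0\ldots0\cdots1\ldots1\,0\ldots0$ with at most $k$ maximal runs of ones. A Hadamard matrix of order $k$ is a matrix $H\in\{-1,1\}^{k\times k}$ with $HH^{\mathsf T}=k\,\mathrm{Id}_k$. *)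

(* Defs.v *)
From mathcomp Require Import all_boot all_algebra.

Set Implicit Arguments.
Unset Strict Implicit.
Unset Printing Implicit Defensive.

Import GRing.Theory.
Local Open Scope ring_scope.

Definition zero_one_mx (R : nzRingType) (m n : nat) (A : 'M[R]_(m, n)) : Prop :=
  forall i j, A i j = 0 \/ A i j = 1.

(* The interval of positions a, a + 1, ..., b is a maximal run of ones in the
   row [r]; the last two clauses are vacuous at the ends of the row. *)
Definition maximal_run (R : nzRingType) (n : nat) (r : 'rV[R]_n)
    (a b : 'I_n) : bool :=
  [&& (a <= b)%N,
      [forall j : 'I_n, (a <= j <= b)%N ==> (r 0 j == 1)],
      [forall j : 'I_n, (j.+1 == a :> nat) ==> (r 0 j != 1)] &
      [forall j : 'I_n, (j == b.+1 :> nat) ==> (r 0 j != 1)]].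

Definition consecutive_ones (R : nzRingType) (k m n : nat)
    (A : 'M[R]_(m, n)) : Prop :=
  forall i : 'I_m,
    (#|[set ab : 'I_n * 'I_n | maximal_run (row i A) ab.1 ab.2]| <= k)%N.

Definition hadamard_mx (R : nzRingType) (k : nat) (H : 'M[R]_k) : Prop :=
  (forall i j, H i j = 1 \/ H i j = -1) /\ H *m H^T = (k%:R)%:M.

(* Main.v *)
(* Upper bound: subtracting from each column the next one does not change the
   determinant, and turns a row with k runs of ones into a row with at most 2k
   nonzero entries, all equal to 1 or -1 (one per start and one per end of a
   run); Hadamard's inequality bounds the result.

   Lower bound: write n = q k, and cut the columns into k groups of q.  The
   first k rows are the indicators of the groups.  The row indexed by 0 < c < q
   and i < k has, in group g, ones exactly at the first c positions if
   H i g = 1, and exactly at the other positions if H i g = -1.  Up to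
   indicators of groups, this row is H i g times the prefix of length c in each
   group g; taking differences inside the groups leaves H i g at a single
   position of group g.  The resulting matrix has orthogonal rows: k of squared
   norm 1 and n - k of squared norm k. *)
Require Import Defs.
From mathcomp Require Import all_boot all_order all_algebra.
From mathcomp Require Import zify ring lra.
From mathcomp Require Import reals exp.

Set Implicit Arguments.
Unset Strict Implicit.
Unset Printing Implicit Defensive.

Import Order.TTheory GRing.Theory Num.Theory.
Local Open Scope ring_scope.

(** * Gram matrices and Hadamard's inequality *)

Lemma mulmx_trE (R : comNzRingType) (m n : nat) (A : 'M[R]_(m, n)) i j :
  (A *m A^T) i j = \sum_l A i l * A j l.
Proof. by rewrite mxE; apply: eq_bigr => l _; rewrite mxE. Qed.

Lemma mulmx_tr_ge0 (R : realDomainType) (m n : nat) (A : 'M[R]_(m, n)) i :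
  0 <= (A *m A^T) i i.
Proof. by rewrite mulmx_trE sumr_ge0 // => l _; rewrite -expr2 sqr_ge0. Qed.

Lemma gram_row_eq0 (R : realDomainType) (n : nat) (v : 'rV[R]_n) :
  v *m v^T = 0 -> v = 0.
Proof.
move=> /matrixP /(_ 0 0); rewrite mulmx_trE mxE => /eqP.
rewrite psumr_eq0 => [/allP v0|i _]; last by rewrite -expr2 sqr_ge0.
apply/rowP => i; have := v0 i (mem_index_enum i).
by rewrite mulf_eq0 orbb mxE => /eqP.
Qed.

(** Induction on the rows: making the first row orthogonal to the others keeps the Gram determinant,
    which then factors, and by Pythagoras only shortens that row. The lower bound is what allows
    multiplying the inequalities. *)
Lemma gram_det_bounds (R : realFieldType) (m n : nat) (A : 'M[R]_(m, n)) :
  0 <= \det (A *m A^T) <= \prod_i (A *m A^T) i i.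
Proof.
elim: m A => [|m IHm] A; first by rewrite det_mx00 big_ord0 ler01 lexx.
rewrite -[A](@vsubmxK _ 1 m n); set a := usubmx _; set B := dsubmx _.
have /andP[detB_ge0 detB_le] := IHm B.
set G := B *m B^T in detB_ge0 detB_le *.
have gramE : col_mx a B *m (col_mx a B)^T =
    block_mx (a *m a^T) (a *m B^T) (B *m a^T) G.
  by rewrite tr_col_mx mul_col_row.
rewrite (@big_split_ord _ _ _ 1 m) big_ord1 /=.
have -> : (col_mx a B *m (col_mx a B)^T) (lshift m 0) (lshift m 0) =
    (a *m a^T) 0 0 by rewrite gramE block_mxEul.
rewrite (eq_bigr (fun i => G i i)); last first.
  by move=> i _; rewrite gramE; exact: block_mxEdr.
(* If [G] is singular, a kernel vector [y] gives a linear relation between the rows of [B], so the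
   larger Gram matrix is singular too. *)
have [/eqP/det0P[y y_neq0 yG]|G_neq0] := eqVneq (\det G) 0.
  suff -> : \det (col_mx a B *m (col_mx a B)^T) = 0.
    rewrite lexx mulr_ge0 ?mulmx_tr_ge0 // prodr_ge0 // => i _.
    exact: mulmx_tr_ge0.
  have yB : y *m B = 0.
    apply: gram_row_eq0.
    by rewrite trmx_mul -mulmxA (mulmxA B) mulmxA yG mul0mx.
  apply/eqP/det0P; exists (row_mx 0 y).
    by apply: contra y_neq0 => /eqP; rewrite -[RHS]row_mx0 => /eq_row_mx[_ ->].
  by rewrite mulmxA mul_row_col yB mul0mx addr0 mul0mx.
(* Replace the first row by its component orthogonal to the others. *)
pose x := a *m B^T *m invmx G; pose e := a - x *m B.
have G_unit : G \in unitmx by rewrite unitmxE unitfE.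
have eB : e *m B^T = 0.
  by rewrite mulmxBl -(mulmxA x) mulmxKV // subrr.
have Be : B *m e^T = 0 by rewrite -[B]trmxK -trmx_mul eB trmx0.
pose L : 'M[R]_(1 + m) := block_mx 1%:M (- x) 0 1%:M.
have detL : \det L = 1 by rewrite det_ublock !det1 mulr1.
have LA : L *m col_mx a B = col_mx e B.
  by rewrite mul_block_col !mul1mx mul0mx add0r mulNmx.
have -> : \det (col_mx a B *m (col_mx a B)^T) = (e *m e^T) 0 0 * \det G.
  rewrite -[LHS]mul1r -[LHS]mulr1 -{1}detL -{1}detL -{2}(det_tr L) -!det_mulmx.
  rewrite mulmxA LA -mulmxA -trmx_mul LA tr_col_mx mul_col_row eB Be.
  by rewrite det_lblock det_mx11.
have a_split : (a *m a^T) 0 0 =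
    (e *m e^T) 0 0 + ((x *m B) *m (x *m B)^T) 0 0.
  have -> : a = e + x *m B by rewrite subrK.
  rewrite [in LHS]linearD /= mulmxDl !mulmxDr trmx_mul (mulmxA e) eB.
  by rewrite mul0mx addr0 -(mulmxA x B e^T) Be mulmx0 add0r mxE.
rewrite mulr_ge0 ?mulmx_tr_ge0 //=.
apply: ler_pM => //; first exact: mulmx_tr_ge0.
by rewrite a_split lerDl mulmx_tr_ge0.
Qed.

Lemma hadamard_inequality (R : realFieldType) (n : nat) (A : 'M[R]_n) :
  (\det A) ^+ 2 <= \prod_i \sum_j (A i j) ^+ 2.
Proof.
have /andP[_] := gram_det_bounds A; rewrite det_mulmx det_tr -expr2.
move=> /le_trans; apply; rewrite le_eqVlt; apply/orP; left; apply/eqP.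
apply: eq_bigr => i _; rewrite mulmx_trE; apply: eq_bigr => j _.
by rewrite expr2.
Qed.

Lemma sum_mul_indicator (R : pzSemiRingType) (I : finType) (P : pred I)
    (F : I -> R) :
  \sum_i F i * (P i)%:R = \sum_(i | P i) F i.
Proof.
by rewrite [RHS]big_mkcond; apply: eq_bigr => i _; rewrite mulr_natr mulrb.
Qed.

Lemma det_unitrig (R : comPzRingType) (n : nat) (A : 'M[R]_n) :
  is_trig_mx A -> (forall i, A i i = 1) -> \det A = 1.
Proof. by move=> /det_trig -> A1; apply: big1. Qed.

(** * Existence and uniqueness of maximal runs *)

Section Runs.
Variables (R : nzRingType) (n : nat) (r : 'rV[R]_n).

Lemma maximal_run_of_end (b : 'I_n) :
  r 0 b = 1 -> (forall j : 'I_n, j = b.+1 :> nat -> r 0 j <> 1) ->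
  exists a, maximal_run r a b.
Proof.
move=> rb rSb.
pose P (a : 'I_n) :=
  (a <= b)%N && [forall j : 'I_n, (a <= j <= b)%N ==> (r 0 j == 1)].
have Pb : P b.
  rewrite /P leqnn; apply/forallP => j; apply/implyP => jb.
  by have -> : j = b; [apply: val_inj => /=; lia | rewrite rb].
(* Extend the run from [b] to the left as far as possible. *)
case: (arg_minnP (@nat_of_ord n) Pb) => a /andP[ab ones] amin.
exists a; apply/and4P; split=> //; apply/forallP => j; apply/implyP => /eqP ja.
  apply/eqP => rj; suff /amin : P j by lia.
  apply/andP; split; first lia.
  apply/forallP => l; apply/implyP => jlb.
  have [->|lj] := eqVneq l j; first by rewrite rj.
  move/forallP/(_ l)/implyP: ones; apply.
  by move: lj; rewrite -val_eqE /=; lia.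
by apply/eqP; apply: rSb.
Qed.

Lemma maximal_run_of_start (a : 'I_n) :
  r 0 a = 1 -> (forall j : 'I_n, j.+1 = a :> nat -> r 0 j <> 1) ->
  exists b, maximal_run r a b.
Proof.
move=> ra rPa.
pose P (b : 'I_n) :=
  (a <= b)%N && [forall j : 'I_n, (a <= j <= b)%N ==> (r 0 j == 1)].
have Pa : P a.
  rewrite /P leqnn; apply/forallP => j; apply/implyP => ja.
  by have -> : j = a; [apply: val_inj => /=; lia | rewrite ra].
case: (arg_maxnP (@nat_of_ord n) Pa) => b /andP[ab ones] bmax.
exists b; apply/and4P; split=> //; apply/forallP => j; apply/implyP => /eqP jb.
  by apply/eqP; apply: rPa.
apply/eqP => rj; suff /bmax : P j by rewrite /=; lia.
apply/andP; split; first lia.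
apply/forallP => l; apply/implyP => jlb.
have [->|lj] := eqVneq l j; first by rewrite rj.
move/forallP/(_ l)/implyP: ones; apply.
by move: lj; rewrite -val_eqE /=; lia.
Qed.

(** If [b < b'], the entry at [b.+1] is a one of the longer run, against the maximality of the
    shorter. *)
Lemma maximal_run_start_inj (a b b' : 'I_n) :
  maximal_run r a b -> maximal_run r a b' -> b = b'.
Proof.
wlog lt_bb' : b b' / (b < b')%N.
  move=> wlg Hb Hb'.
  case: (ltngtP b b') => [lt|lt|/val_inj//]; first exact: wlg.
  by symmetry; apply: wlg.
case/and4P=> ab _ _ /forallP end_b /and4P[_ /forallP ones _ _].
have Sb : (b.+1 < n)%N by apply: leq_ltn_trans (ltn_ord b').
have := end_b (Ordinal Sb); have := ones (Ordinal Sb).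
by rewrite /= eqxx lt_bb' (leq_trans ab) //= => ->.
Qed.

End Runs.

(** * The upper bound, by column differences *)

Section UpperBound.
Variable R : realFieldType.

Definition diff_mx n : 'M[R]_n :=
  \matrix_(i, j) ((i == j)%:R - (i == j.+1 :> nat)%:R).

Lemma det_diff_mx n : \det (diff_mx n) = 1.
Proof.
apply: det_unitrig => [|i]; last first.
  rewrite mxE eqxx (_ : (_ == _ :> nat) = false) ?subr0 //.
  by apply/eqP; lia.
apply/is_trig_mxP => i j ij; rewrite mxE.
rewrite (_ : (_ == _ :> nat) = false); last by apply/eqP; lia.
by rewrite -val_eqE /= ltn_eqF // subrr.
Qed.

Lemma mulmx_diffE m n (A : 'M[R]_(m, n)) i j :
  (A *m diff_mx n) i j = A i j - \sum_(l < n | l == j.+1 :> nat) A i l.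
Proof.
rewrite mxE (eq_bigr (fun l => A i l * (l == j)%:R -
    A i l * (l == j.+1 :> nat)%:R)) => [|l _]; last by rewrite mxE mulrBr.
by rewrite sumrB !sum_mul_indicator big_pred1_eq.
Qed.

Lemma mulmx_diff_row_norm k m n (A : 'M[R]_(m, n)) i :
  zero_one_mx A -> consecutive_ones k A ->
  \sum_j ((A *m diff_mx n) i j) ^+ 2 <= 2 * k%:R.
Proof.
move=> A01 /(_ i); set S := [set ab | _] => card_S.
pose starts := [set ab.1 | ab in S]; pose ends := [set ab.2 | ab in S].
have card_starts : (#|starts| <= k)%N := leq_trans (leq_imset_card _ _) card_S.
have card_ends : (#|ends| <= k)%N := leq_trans (leq_imset_card _ _) card_S.
(* A difference is nonzero only where [j] ends a run or [j.+1] starts one. Writing the second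
   indicator as a sum over [starts] covers the last column, where [j.+1] is no index, and lets the
   sums be exchanged. *)
have bound j : ((A *m diff_mx n) i j) ^+ 2 <=
    (j \in ends)%:R + \sum_(l in starts) (l == j.+1 :> nat)%:R.
  have sum_ge0 : 0 <= \sum_(l in starts) (l == j.+1 :> nat)%:R :> R.
    by apply: sumr_ge0 => l _; apply: ler0n.
  have start (l : 'I_n) : l = j.+1 :> nat -> A i l = 1 -> A i j = 0 ->
      1 <= \sum_(l in starts) (l == j.+1 :> nat)%:R :> R.
    move=> lj Al Aj; have l_in : l \in starts.
      have [|j' /eqP|b run] := @maximal_run_of_start _ _ (row i A) l.
      - by rewrite mxE.
      - rewrite mxE lj eqSS => /eqP/val_inj ->; rewrite Aj => /eqP.
        by rewrite eq_sym oner_eq0.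
      - by apply/imsetP; exists (l, b); rewrite ?inE.
    rewrite (bigD1 l) //= lj eqxx lerDl.
    by apply: sumr_ge0 => l' _; apply: ler0n.
  have end_j : A i j = 1 -> (forall l : 'I_n, l = j.+1 :> nat -> A i l = 0) ->
      j \in ends.
    move=> Aj Al; have [|l lj|a run] := @maximal_run_of_end _ _ (row i A) j.
    - by rewrite mxE.
    - by rewrite mxE Al // => /eqP; rewrite eq_sym oner_eq0.
    - by apply/imsetP; exists (a, j); rewrite ?inE.
  rewrite mulmx_diffE; have [Sj|nSj] := ltnP j.+1 n.
    rewrite (big_pred1 (Ordinal Sj)) //.
    case: (A01 i j) => Aj; case: (A01 i (Ordinal Sj)) => Al.
    - by rewrite Aj Al subrr expr0n addr_ge0 // ler0n.
    - rewrite Aj Al sub0r sqrrN expr1n (le_trans (start (Ordinal Sj) _ _ _)) //.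
      by rewrite lerDr ler0n.
    - rewrite end_j // => [|l lj]; last first.
        by rewrite -Al; congr (A i _); apply: val_inj.
      by rewrite Aj Al subr0 expr1n lerDl.
    - by rewrite Aj Al subrr expr0n addr_ge0 // ler0n.
  rewrite big_pred0 ?subr0 => [|l]; last first.
    by apply/eqP => lj; have := ltn_ord l; rewrite lj ltnNge nSj.
  case: (A01 i j) => Aj; first by rewrite Aj expr0n addr_ge0 // ler0n.
  rewrite end_j // => [|l lj]; first by rewrite Aj expr1n lerDl.
  by have := ltn_ord l; rewrite lj ltnNge nSj.
apply: le_trans (ler_sum _ (fun j _ => bound j)) _.
rewrite big_split exchange_big /= mulr_natl mulr2n lerD //.
  by rewrite -natr_sum ler_nat -big_mkcond sum1_card.
apply: (@le_trans _ _ (\sum_(l in starts) 1)); last first.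
  by rewrite sumr_const ler_nat.
(* A start [l] is counted only at [j = l.-1], and not at all if [l = 0]. *)
apply: ler_sum => l _; case: (posnP l) => [l0|l_gt0].
  by rewrite big1 ?ler01 // => j _; rewrite l0.
have l_pred : (l.-1 < n)%N by apply: leq_ltn_trans (ltn_ord l); apply: leq_pred.
rewrite (bigD1 (Ordinal l_pred)) //= big1 ?addr0 => [|j jl].
  by rewrite lern1 leq_b1.
by move: jl; rewrite -val_eqE /= => jl; case: eqP => // ?; lia.
Qed.

Lemma det_consecutive_ones k n (A : 'M[R]_n) :
  zero_one_mx A -> consecutive_ones k A -> (\det A) ^+ 2 <= (2 * k%:R) ^+ n.
Proof.
move=> A01 Ak; have := hadamard_inequality (A *m diff_mx n).
rewrite det_mulmx det_diff_mx mulr1 => /le_trans; apply.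
rewrite -[X in _ ^+ X]card_ord -prodr_const; apply: ler_prod => i _.
rewrite mulmx_diff_row_norm // andbT; apply: sumr_ge0 => j _; exact: sqr_ge0.
Qed.

End UpperBound.

(** * Iterated sums and products over quotient and remainder *)

Lemma big_ord_divmod (R : Type) (idx : R) (op : Monoid.law idx) (n a b : nat)
    (F : nat -> nat -> R) :
  n = (a * b)%N ->
  \big[op/idx]_(i < n) F (i %/ b)%N (i %% b)%N =
  \big[op/idx]_(x < a) \big[op/idx]_(y < b) F x y.
Proof.
move=> ->; rewrite -(big_mkord xpredT (fun i => F (i %/ b)%N (i %% b)%N)).
rewrite big_nat_mul big_mkord; apply: eq_bigr => x _.
rewrite -{1}[(x * b)%N]add0n big_addn mulSn addnK big_mkord.
apply: eq_bigr => y _.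
have b_gt0 : (0 < b)%N by apply: leq_ltn_trans (ltn_ord y).
by rewrite addnC divnMDl // divn_small // addn0 modnMDl modn_small.
Qed.

Lemma sum_ord_mul_eq (R : pzSemiRingType) (n g : nat) (F : nat -> R) :
  (g < n)%N -> \sum_(y < n) F y * (y == g :> nat)%:R = F g.
Proof.
by move=> gn; rewrite sum_mul_indicator (big_pred1 (Ordinal gn)).
Qed.

(** * The matrix built from a Hadamard matrix *)

Section Construction.
Variables (R : realFieldType) (k' q' : nat) (H : 'M[R]_k'.+1).
Hypothesis hadamardH : hadamard_mx H.
Let k := k'.+1.
Let q := q'.+1.
Let n := (q * k)%N.
Let h (i g : nat) : R := H (inord i) (inord g).

Let rowK (r : 'I_n) : (r %/ k < q)%N. Proof. by rewrite ltn_divLR. Qed.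
Let rowI (r : 'I_n) : (r %% k < k)%N. Proof. by rewrite ltn_mod. Qed.
Let colG (j : 'I_n) : (j %/ q < k)%N. Proof. by rewrite ltn_divLR // mulnC. Qed.
Let colC (j : 'I_n) : (j %% q < q)%N. Proof. by rewrite ltn_mod. Qed.
Let n_kq : n = (k * q)%N. Proof. exact: mulnC. Qed.

Let h_pm1 i g : h i g = 1 \/ h i g = -1.
Proof. by case: hadamardH => pm1 _; apply: pm1. Qed.

Let m1_neq1 : (-1 == 1 :> R) = false.
Proof. by apply/negbTE; rewrite lt_eqF //; lra. Qed.

Let h_orth i i' : (i < k)%N -> (i' < k)%N ->
  \sum_(g < k) h i g * h i' g = k%:R * (i == i')%:R.
Proof.
move=> ik i'k; case: hadamardH => _ /matrixP/(_ (inord i) (inord i')).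
rewrite mulmx_trE mxE -val_eqE /= !inordK // mulr_natr => <-.
  by apply: eq_bigr => g _; rewrite /h inord_val.
Qed.

(* The row [r] has indices [c = r %/ k] and [i = r %% k]; the column [j] is the
   position [j %% q] of the group [j %/ q]. *)
Definition hadamard_blocks : 'M[R]_n :=
  \matrix_(r, j) if (r %/ k == 0)%N then (j %/ q == r %% k)%N%:R
    else ((j %% q < r %/ k)%N == (h (r %% k) (j %/ q) == 1))%:R.

Let weight (c i g : nat) : R := if c == 0%N then (g == i)%:R else h i g.
(** Last position of the prefix used by the row: the indicator of a group is its prefix of full
    length [q], hence [q'] for [c = 0]. *)
Let pivot (c : nat) : nat := if c == 0%N then q' else c.-1.

Let pivot_lt (r : 'I_n) : (pivot (r %/ k) < q)%N.
Proof.
rewrite /pivot; case: eqP => // _.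
by apply: leq_ltn_trans (rowK r); apply: leq_pred.
Qed.

Definition sparse_mx : 'M[R]_n := \matrix_(r, j)
  (weight (r %/ k) (r %% k) (j %/ q) * (j %% q == pivot (r %/ k))%N%:R).

(** Inverse of taking differences inside the groups: on the right, it turns a single entry at
    [pivot] into a constant prefix. *)
Definition suffix_sum_mx : 'M[R]_n :=
  \matrix_(l, j) ((l %/ q == j %/ q) && (j %% q <= l %% q))%N%:R.

(** On the left, it adds the indicator of each group where [h] is -1, turning minus a prefix into
    the indicator of its complement. *)
Definition complement_mx : 'M[R]_n := \matrix_(r, s) ((r == s)%:R +
  [&& (0 < r %/ k)%N, (s %/ k == 0)%N & h (r %% k) (s %% k) == -1]%:R).

Lemma det_suffix_sum_mx : \det suffix_sum_mx = 1.
Proof.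
apply: det_unitrig => [|i]; last by rewrite mxE eqxx leqnn.
apply/is_trig_mxP => i j ij; rewrite mxE.
case: eqP => //= eq_g; rewrite leqNgt; case: ltnP => // le_c; exfalso.
have := divn_eq i q; have := divn_eq j q; rewrite eq_g; lia.
Qed.

Lemma det_complement_mx : \det complement_mx = 1.
Proof.
apply: det_unitrig => [|i]; last first.
  by rewrite mxE eqxx; case: posnP => _ /=; rewrite addr0.
apply/is_trig_mxP => i j ij; rewrite mxE -val_eqE /= ltn_eqF // add0r.
case: posnP => //= i_gt0; case: eqP => //= j0.
by have := leq_div2r k (ltnW ij); rewrite j0 leqn0 -[_ == _]negbK -lt0n i_gt0.
Qed.

Lemma mul_sparse_suffixE r j : (sparse_mx *m suffix_sum_mx) r j =
  weight (r %/ k) (r %% k) (j %/ q) * (j %% q <= pivot (r %/ k))%N%:R.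
Proof.
rewrite mxE; pose F x y := weight (r %/ k) (r %% k) x *
  ((j %% q <= y)%N%:R * (y == pivot (r %/ k))%:R) * (x == (j %/ q)%N)%:R.
rewrite (eq_bigr (fun l : 'I_n => F (l %/ q)%N (l %% q)%N)); last first.
  by move=> l _; rewrite !mxE /F -mulnb natrM; ring.
rewrite (big_ord_divmod _ F n_kq) /F.
under eq_bigr => x _ do rewrite -big_distrl -big_distrr /=.
rewrite (sum_ord_mul_eq (fun x => weight _ _ x * _)) //; congr (_ * _).
by rewrite (sum_ord_mul_eq (fun y => (j %% q <= y)%N%:R)).
Qed.

Lemma hadamard_blocksE :
  hadamard_blocks = complement_mx *m (sparse_mx *m suffix_sum_mx).
Proof.
apply/matrixP => r j; rewrite mxE [RHS]mxE.
pose F x y := (0 < r %/ k)%N%:R * (h (r %% k) y == -1)%:R *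
  (weight x y (j %/ q) * (j %% q <= pivot x)%N%:R) * (x == 0%N)%:R.
rewrite (eq_bigr (fun s : 'I_n => (sparse_mx *m suffix_sum_mx) s j *
    (s == r)%:R + F (s %/ k)%N (s %% k)%N)); last first.
  move=> s _; rewrite [complement_mx _ _]mxE mul_sparse_suffixE /F eq_sym.
  by rewrite -!mulnb !natrM; ring.
rewrite big_split /= sum_mul_indicator big_pred1_eq mul_sparse_suffixE.
rewrite (big_ord_divmod _ F (erefl n)) /F exchange_big /=.
under eq_bigr => y _ do rewrite (sum_ord_mul_eq (fun x => _ *
  (weight x y (j %/ q) * (j %% q <= pivot x)%N%:R))) //.
have le_q' : (j %% q <= q')%N by rewrite -ltnS.
rewrite /weight /pivot /= le_q'.
rewrite (eq_bigr (fun y : 'I_k => (0 < r %/ k)%N%:R *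
  (h (r %% k) y == -1)%:R * (val y == j %/ q)%N%:R)); last first.
  by move=> y _; rewrite mulr1 (eq_sym (val y)).
rewrite (sum_ord_mul_eq (fun y => _ * (h _ y == -1)%:R)) //.
case: posnP => [r0|r_gt0]; first by rewrite /= le_q' !mul0r addr0 mulr1.
rewrite -[(_ <= _.-1)%N]ltnS prednK // mul1r.
case: (h_pm1 (r %% k) (j %/ q)) => ->;
  rewrite eqxx ?m1_neq1 ?(eq_sym 1) ?m1_neq1.
  by rewrite mul1r addr0; case: ltnP.
by case: ltnP => _ /=; rewrite ?mulr0 ?mulr1 ?add0r ?addNr.
Qed.

(** The outer factors have determinant 1, so the square is the Gram determinant of [sparse_mx]. Rows
    with distinct quotients have disjoint supports; those with equal quotients are orthogonal by
    [h_orth] or as indicators. *)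
Lemma det_hadamard_blocks : (\det hadamard_blocks) ^+ 2 = k%:R ^+ (q' * k).
Proof.
rewrite hadamard_blocksE !det_mulmx det_suffix_sum_mx det_complement_mx.
rewrite mul1r mulr1 expr2 -{2}det_tr -det_mulmx.
pose d (x : nat) : R := if x == 0%N then 1 else k%:R.
have -> : sparse_mx *m sparse_mx^T = diag_mx (\row_(r < n) d (r %/ k)%N).
  apply/matrixP => r s; rewrite mulmx_trE !mxE.
  pose F x y := weight (r %/ k) (r %% k) x * weight (s %/ k) (s %% k) x *
    ((y == pivot (s %/ k))%:R * (y == pivot (r %/ k))%:R).
  rewrite (eq_bigr (fun l : 'I_n => F (l %/ q)%N (l %% q)%N)); last first.
    by move=> l _; rewrite !mxE /F; ring.
  rewrite (big_ord_divmod _ F n_kq) /F.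
  under eq_bigr => x _ do rewrite -big_distrr /=
    (sum_ord_mul_eq (fun y => (y == pivot (s %/ k))%:R)) //.
  rewrite -big_distrl /=.
  have eq_rs : (r == s) = (r %/ k == s %/ k)%N && (r %% k == s %% k)%N.
    apply/eqP/andP => [->//|[/eqP ec /eqP ei]]; apply: val_inj.
    by rewrite /= (divn_eq r k) (divn_eq s k) ec ei.
  (* [pivot] is injective below [q]: it sends 0 to [q'] and the others below [q']. *)
  have -> : (pivot (r %/ k) == pivot (s %/ k)) = (r %/ k == s %/ k)%N.
    have := rowK r; have := rowK s; rewrite /pivot.
    by move: (r %/ k)%N (s %/ k)%N => [|x] [|y] /=; rewrite /q; lia.
  rewrite eq_rs; case: eqP => [ec|]; last by rewrite mulr0.
  rewrite /weight -ec /d; case: eqP => _ /=; rewrite mulr1 -mulr_natr.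
    by rewrite (sum_ord_mul_eq (fun x => (x == r %% k)%N%:R)) // mul1r eq_sym.
  by rewrite mul1r h_orth // mulr_natr.
rewrite det_diag (eq_bigr (fun r : 'I_n => d (r %/ k)%N)); last first.
  by move=> r _; rewrite mxE.
rewrite (big_ord_divmod _ (fun x _ => d x) (erefl n)) big_ord_recl /=.
rewrite big1 // mul1r mulnC exprM.
rewrite (eq_bigr (fun _ => k%:R ^+ k)) => [|x _]; last first.
  by rewrite prodr_const card_ord.
by rewrite prodr_const card_ord.
Qed.

Lemma hadamard_blocks01 : zero_one_mx hadamard_blocks.
Proof.
have b01 (b : bool) : b%:R = 0 :> R \/ b%:R = 1 :> R.
  by case: b; [right|left].
by move=> r j; rewrite mxE; case: ifP => _; apply: b01.
Qed.

(* In each group of [q] consecutive columns the row [r] is a prefix, a suffix or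
   constant, so the group contains at most one start of a run. *)
Lemma run_start_hadamard_blocks r a b :
  maximal_run (row r hadamard_blocks) a b ->
  (a %% q)%N = if (r %/ k == 0)%N || (h (r %% k) (a %/ q) == 1) then 0%N
               else (r %/ k)%N.
Proof.
case/and4P=> ab /forallP ones /forallP start _.
have := ones a; rewrite leqnn ab /= => /eqP Aa.
(* Unless [a] opens its group, its left neighbour is in the same group and is not a one. *)
have prev (a_gt0 : (0 < a %% q)%N) : exists l : 'I_n, [/\ (l %/ q = a %/ q)%N,
    (l %% q).+1 = (a %% q)%N & row r hadamard_blocks 0 l != 1].
  have a_gt0' : (0 < a)%N by case: (posnP a) a_gt0 => // ->; rewrite mod0n.
  have ltl : (a.-1 < n)%N by apply: leq_ltn_trans (ltn_ord a); apply: leq_pred.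
  have al : a.-1 = (a %/ q * q + (a %% q).-1)%N.
    by rewrite {1}(divn_eq a q) -!subn1 addnBA.
  have lt_q : ((a %% q).-1 < q)%N.
    by apply: leq_ltn_trans (colC a); apply: leq_pred.
  exists (Ordinal ltl); split => /=.
  - by rewrite al divnMDl // (divn_small lt_q) addn0.
  - by rewrite al modnMDl (modn_small lt_q) prednK.
  - by have := start (Ordinal ltl); rewrite /= prednK // eqxx.
move: Aa; rewrite !mxE; case: posnP => [r0|r_gt0] /=.
  move=> Aa; case: (posnP (a %% q)) => // /prev[l [lg _]].
  by rewrite !mxE r0 /= lg Aa eqxx.
have := oner_neq0 R; rewrite eq_sym => neq01.
case: (h (r %% k) (a %/ q) =P 1) => [h1|/eqP h1].
  move=> Aa; case: (posnP (a %% q)) => // /prev[l [lg lc]].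
  rewrite !mxE gtn_eqF // lg h1 eqxx /=.
  case: ltnP Aa => [ltc _|_ /eqP]; last by rewrite (negPf neq01).
  by rewrite (ltn_trans _ ltc) ?eqxx // -lc.
move=> Aa; case: (ltngtP (a %% q) (r %/ k)) Aa => //= [_ /eqP|gtc _].
  by rewrite (negPf neq01).
have /prev[l [lg lc]] : (0 < a %% q)%N by apply: leq_trans gtc.
rewrite !mxE gtn_eqF // lg (negPf h1).
by rewrite ltnNge -ltnS lc gtc eqxx.
Qed.

(** Sending a run to the group of its start is injective, since the group fixes the start and the
    start fixes the end; there are [k] groups. *)
Lemma consecutive_ones_hadamard_blocks : consecutive_ones k hadamard_blocks.
Proof.
move=> r; rewrite -[X in (_ <= X)%N]card_ord.
pose group (ab : 'I_n * 'I_n) := Ordinal (colG ab.1).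
rewrite -(@card_in_imset _ _ group) ?max_card // => -[a b] [a' b'].
rewrite !inE /= => run run' [eq_g].
have eq_a : a = a'.
  apply: val_inj; rewrite /= (divn_eq a q) (divn_eq a' q).
  rewrite (run_start_hadamard_blocks run).
  by rewrite (run_start_hadamard_blocks run') eq_g.
by rewrite -eq_a in run' *; rewrite (maximal_run_start_inj run run').
Qed.

End Construction.

Theorem theorem9 (R : realType) :
  (forall (k n : nat) (A : 'M[R]_n),
      (0 < k)%N -> (0 < n)%N ->
      zero_one_mx A -> consecutive_ones k A ->
      `|\det A| <= (2 * k%:R) `^ (n%:R / 2))
  /\
  (forall k : nat, (0 < k)%N ->
      (exists H : 'M[R]_k, hadamard_mx H) ->
      forall n : nat, (0 < n)%N -> (k %| n)%N ->
      exists A : 'M[R]_n,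
        [/\ zero_one_mx A, consecutive_ones k A
          & `|\det A| = k%:R `^ ((n%:R - k%:R) / 2)]).
Proof.
(* Both claims are compared after squaring, which removes the half exponents. *)
have powR_half_sqr (a x : R) : (a `^ (x / 2)) ^+ 2 = a `^ x.
  by rewrite -powR_mulrn ?powR_ge0 // -powRrM divfK ?pnatr_eq0.
split=> [k n A _ _ A01 Ak|[//|k] _ [H hadH] n n_gt0 /dvdnP[[|q] def_n]].
- rewrite -(@ler_pXn2r _ 2) ?nnegrE ?powR_ge0 ?normr_ge0 //.
  rewrite powR_half_sqr powR_mulrn ?mulr_ge0 ?ler0n //.
  by rewrite real_normK ?num_real //; exact: (det_consecutive_ones A01 Ak).
- by rewrite def_n in n_gt0.
subst n; exists (hadamard_blocks q H); split.
- exact: hadamard_blocks01.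
- exact: consecutive_ones_hadamard_blocks.
apply/eqP; rewrite -(@eqrXn2 _ 2) ?powR_ge0 ?normr_ge0 //.
rewrite powR_half_sqr real_normK ?num_real // det_hadamard_blocks //.
(* With [q.+1] columns per group, [n - k] is [q * k.+1], a natural exponent. *)
by rewrite -natrB ?leq_pmull // mulSn addKn powR_mulrn // ler0n.
Qed.
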